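(* Let $F$ be a field of arbitrary characteristic. (A1) Every countably generated symplectic vector space $(V,\omega)$ over $F$ has a symplectic basis. When $V\neq\{0\}$ and the dimension of $V$ is finite, it must be even: $\dim V=2r$ for some $r\in\{1,2,\dots\}$. (A2) Let $\omega$ be a skew-symmetric bilinear form on a countably generated vector space $V$ over $F$, let $K=\{x\in V:\omega(x,V)=\{0\}\}$ be the kernel of $\omega$, and let $L$ be any vector space complement, $V=K\oplus L$. Then the restriction $\omega_L$ of $\omega$ to $L\times L$ is a symplectic form. If $L'$ is any other complement, $V=K\oplus L'$, then the symplectic spaces $(L,\omega_L)$ and $(L',\omega_{L'})$ are congruent.
   Context: A vector space $V$ over $F$ is countably generated if there is a sequence $v_1,v_2,\dots\in V$ such that every element of $V$ is a finite linear combination of the $v_k$. A bilinear form $B:V\times V\to F$ is skew-symmetric if $B(x,y)=-B(y,x)$ and $B(x,x)=0$ for all $x,y\in V$ (the second condition follows from the first if $\operatorname{char}F\neq 2$). Its kernel is $\{x\in V: B(x,V)=\{0\}\}$. $B$ is symplectic if it is skew-symmetric and has kernel $\{0\}$. A symplectic vector space is a pair $(V,B)$ consisting of a countably generated vector space $V$ over $F$ and a symplectic bilinear form $B:V\times V\to F$. Two symplectic vector spaces $(V,B)$, $(V',B')$ over $F$ are congruent if there is a linear isomorphism $T:V\to V'$ with $B'(Tx,Ty)=B(x,y)$ for all $x,y\in V$. A symplectic basis for $(V,\omega)$ is a pair of sequences $e_1,e_2,\dots$ and $f_1,f_2,\dots$ in $V$, either both infinite or both finite of the same length, such that $\omega(e_i,e_j)=0$,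 $\omega(f_i,f_j)=0$, $\omega(e_i,f_j)=\delta_{ij}$ for all $i,j$, and such that every element of $V$ is a finite linear combination of the elements $e_i,f_j$. *)

(* Defs.v *)
(* Vector spaces of arbitrary dimension over F are [lmodType F], and bilinear
   forms V x V -> F are the library's [{biscalar V}].  The library's
   [is_symplectic] and [\dim] are not used, as they require a [vectType], i.e.
   finite dimension. *)
From HB Require Import structures.
From mathcomp Require Import all_boot all_order all_algebra.
From mathcomp Require Import boolp classical_sets.

Set Implicit Arguments.
Unset Strict Implicit.
Unset Printing Implicit Defensive.

Import GRing.Theory.
Local Open Scope classical_set_scope.
Local Open Scope ring_scope.

Section Generation.
Context {F : fieldType} {V : lmodType F}.

Definition lin_span (A : set V) : set V :=
  [set x | exists (n : nat) (c : 'I_n -> F) (u : 'I_n -> V),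
             (forall i, A (u i)) /\ x = \sum_(i < n) c i *: u i].

Definition lin_indep (n : nat) (b : 'I_n -> V) : Prop :=
  forall c : 'I_n -> F, \sum_(i < n) c i *: b i = 0 -> forall i, c i = 0.

End Generation.

Definition countably_generated (F : fieldType) (V : lmodType F) : Prop :=
  exists v : nat -> V, forall x : V, lin_span (range v) x.

Definition has_dim (F : fieldType) (V : lmodType F) (n : nat) : Prop :=
  exists b : 'I_n -> V, lin_indep b /\ forall x : V, lin_span (range b) x.

Section Forms.
Context {F : fieldType} {V : lmodType F}.
Implicit Type w : {biscalar V}.

Definition skew_form w : Prop :=
  forall x y : V, w x y = - w y x /\ w x x = 0.

Definition form_kernel w : set V := [set x | forall y : V, w x y = 0].

Definition symplectic_form w : Prop :=
  skew_form w /\ form_kernel w = [set 0].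

Definition symplectic_space w : Prop :=
  countably_generated V /\ symplectic_form w.

Definition symplectic_basis w (I : eqType) (e f : I -> V) : Prop :=
  [/\ forall i j, w (e i) (e j) = 0,
      forall i j, w (f i) (f j) = 0,
      forall i j, w (e i) (f j) = (i == j)%:R
    & forall x : V, lin_span (range e `|` range f) x].

(* The two sequences are either both infinite (indexed by nat) or both of the
   same finite length r, with r = 0 allowed. *)
Definition has_symplectic_basis w : Prop :=
  (exists e f : nat -> V, symplectic_basis w e f) \/
  (exists (r : nat) (e f : 'I_r -> V), symplectic_basis w e f).

End Forms.

Definition congruent (F : fieldType) (V V' : lmodType F)
    (w : {biscalar V}) (w' : {biscalar V'}) : Prop :=
  exists T : {linear V -> V'},
    bijective T /\ forall x y : V, w' (T x) (T y) = w x y.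

(* A linear subspace L of V, seen as a vector space in its own right. Membership
   in a [submodClosed V] is Boolean, but by excluded middle in boolp every
   linear subspace of V arises in this way. *)
Definition subspace (F : fieldType) (V : lmodType F) (L : submodClosed V) :
  Type := {x : V | x \in L}.

HB.instance Definition _ (F : fieldType) (V : lmodType F)
    (L : submodClosed V) :=
  [isSub of subspace L for @sval V (fun x => x \in L)].
HB.instance Definition _ (F : fieldType) (V : lmodType F)
    (L : submodClosed V) :=
  [Choice of subspace L by <:].
HB.instance Definition _ (F : fieldType) (V : lmodType F)
    (L : submodClosed V) :=
  [SubChoice_isSubLmodule of subspace L by <:].

Definition restr (F : fieldType) (V : lmodType F) (w : {biscalar V})
  (L : submodClosed V) (x y : subspace L) : F := w (val x) (val y).

Lemma restr_bilinear (F : fieldType) (V : lmodType F) (w : {biscalar V})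
  (L : submodClosed V) :
  @bilinear_for F (subspace L) (subspace L) F *%R *%R (restr w (L := L)).
Proof.
split=> u a x y; rewrite /restr.
  by rewrite (_ : val _ = a *: val x + val y) // linearDl linearZl_LR.
by rewrite (_ : val (_ + _) = a *: val x + val y) // linearDr linearZr_LR.
Qed.

HB.instance Definition _ (F : fieldType) (V : lmodType F) (w : {biscalar V})
    (L : submodClosed V) :=
  bilinear_isBilinear.Build F (subspace L) (subspace L) F *%R *%R
    (@restr F V w L) (restr_bilinear w L).

(* V = K (+) L *)
Definition complementary (F : fieldType) (V : lmodType F) (K : set V)
    (L : submodClosed V) : Prop :=
  (forall x : V, exists k l : V, [/\ K k, l \in L & x = k + l]) /\
  (forall x : V, K x -> x \in L -> x = 0).

Notation "w |_[ L ]" := (@restr _ _ w L : {biscalar (subspace L)})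
  (at level 10, L at level 100, format "w  |_[ L ]").

(* Main.v *)
(** Greedy symplectic Gram-Schmidt: a finite family of mutually orthogonal
    hyperbolic pairs splits off orthogonally, so a vector outside its span can
    be corrected to be orthogonal to the family; nondegeneracy then yields a
    partner and a new pair.  Either some finite family spans V, or the process
    never stops and, run along a generating sequence, exhausts V.  For (A2), the
    form does not see the kernel, so the projections of L' onto L and of L onto
    L' along the kernel are mutually inverse congruences. *)
Require Import Defs.
From HB Require Import structures.
From mathcomp Require Import all_boot all_order all_algebra.
From mathcomp Require Import boolp classical_sets.
From mathcomp Require Import ring.

Local Open Scope ring_scope.

Set Implicit Arguments.
Unset Strict Implicit.
Unset Printing Implicit Defensive.

Import GRing.Theory.

(** * Linear spans, and the bound of independent families by spanning ones *)

Section Span.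
Context {F : fieldType} {V : lmodType F}.
Implicit Types (A B : set V) (x y : V).

Lemma lin_span_ind A (P : V -> Prop) :
    P 0 -> (forall a x y, P x -> P y -> P (a *: x + y)) ->
    (forall x, A x -> P x) -> forall x, lin_span A x -> P x.
Proof.
move=> P0 PD PA _ [n [c [u [Au ->]]]].
elim/big_ind: _ => // [x y Px Py|i _].
  by rewrite -[x]scale1r; apply: PD.
by rewrite -[_ *: _]addr0; apply: PD => //; apply: PA.
Qed.

Lemma lin_span0 A : lin_span A 0.
Proof.
by exists 0%N, (fun=> 0), (fun=> 0); split=> [[]//|]; rewrite big_ord0.
Qed.

Lemma sub_lin_span A x : A x -> lin_span A x.
Proof.
by move=> Ax; exists 1, (fun=> 1), (fun=> x); rewrite big_ord1 scale1r.
Qed.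

Lemma lin_spanP A a x y :
  lin_span A x -> lin_span A y -> lin_span A (a *: x + y).
Proof.
move=> [m [c [u [Au ->]]]] [n [d [v [Av ->]]]].
exists (m + n)%N,
  (fun i => match split i with inl j => a * c j | inr j => d j end),
  (fun i => match split i with inl j => u j | inr j => v j end); split.
  by move=> i; case: (split i).
rewrite big_split_ord /= scaler_sumr; congr (_ + _); apply: eq_bigr => i _.
  by rewrite (unsplitK (inl i)) scalerA.
by rewrite (unsplitK (inr i)).
Qed.

Lemma lin_span_trans A B x :
  (forall y, A y -> lin_span B y) -> lin_span A x -> lin_span B x.
Proof.
move=> AB; move: x; apply: lin_span_ind => // [|a y z].
  exact: lin_span0.
exact: lin_spanP.
Qed.

Lemma lin_span_mono A B x :
  (forall y, A y -> B y) -> lin_span A x -> lin_span B x.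
Proof. by move=> AB; apply: lin_span_trans => y /AB; apply: sub_lin_span. Qed.

Lemma lin_span_range n (b : 'I_n -> V) x :
  lin_span (range b) x -> exists c : 'I_n -> F, x = \sum_(i < n) c i *: b i.
Proof.
move: x; apply: lin_span_ind => [|a _ _ [c ->] [d ->]|_ [i _ <-]].
- by exists (fun=> 0); rewrite big1 // => i _; rewrite scale0r.
- exists (fun i => a * c i + d i); rewrite scaler_sumr -big_split.
  by apply: eq_bigr => i _; rewrite scalerDl scalerA.
exists (fun j => (j == i)%:R); rewrite (bigD1 i) //= eqxx scale1r big1 ?addr0 //.
by move=> j /negPf->; rewrite scale0r.
Qed.

(** The coordinates of the [b i] in terms of [c] form an [m] by [n] matrix. A relation among its
    rows would be a relation among the [b i], so its rank is [m], which is at most [n]. *)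
Lemma lin_indep_leq m n (b : 'I_m -> V) (c : 'I_n -> V) :
  lin_indep b -> (forall x, lin_span (range c) x) -> (m <= n)%N.
Proof.
move=> b_free c_span.
have /choice[M bE] i := lin_span_range (c_span (b i)).
pose A := \matrix_(i < m, j < n) M i j.
suff /eqP <- : row_free A by apply: rank_leq_col.
apply: inj_row_free => u uA0; apply/rowP => i; rewrite mxE.
apply: (b_free (fun i => u 0 i)).
under eq_bigr => k _ do rewrite bE scaler_sumr.
rewrite exchange_big big1 // => j _.
under eq_bigr => k _ do rewrite scalerA.
rewrite -scaler_suml; have /rowP/(_ j) := uA0; rewrite !mxE.
by under eq_bigr => k _ do rewrite mxE; move=> ->; rewrite scale0r.
Qed.

End Span.

(** * Hyperbolic pairs and the construction of a symplectic basis *)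

Section SymplecticBasis.
Context {F : fieldType} {V : lmodType F} (w : {biscalar V}).
Hypothesis w_skew : skew_form w.
Implicit Types (p q : V * V) (s : seq (V * V)) (x y z u : V).

Let wC x y : w x y = - w y x. Proof. by case: (w_skew x y). Qed.
Let wxx x : w x x = 0. Proof. by case: (w_skew x x). Qed.

Definition pair_orth p q :=
  [&& w p.1 q.1 == 0, w p.1 q.2 == 0, w p.2 q.1 == 0 & w p.2 q.2 == 0].

Lemma pair_orthC p q : pair_orth p q -> pair_orth q p.
Proof.
case/and4P => pq1 pq2 pq3 pq4; apply/and4P.
by split; rewrite wC oppr_eq0.
Qed.

Definition hyperbolic s :=
  pairwise pair_orth s && all (fun p => w p.1 p.2 == 1) s.

Definition pair_vectors s : set V :=
  [set x | exists2 p, p \in s & x = p.1 \/ x = p.2]%classic.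

Definition orth_to s x := forall p, p \in s -> w x p.1 = 0 /\ w x p.2 = 0.

Lemma pair_vectors_cons p s x : pair_vectors s x -> pair_vectors (p :: s) x.
Proof. by case=> q qs qx; exists q; rewrite // inE qs orbT. Qed.

Lemma orth_to_span s x y :
  orth_to s x -> lin_span (pair_vectors s) y -> w x y = 0.
Proof.
move=> xs; move: y; apply: lin_span_ind => [|a y z xy xz|y [p /xs[xp1 xp2]] [] ->] //.
  by rewrite linear0r.
by rewrite linearDr linearZr_LR /= xy xz mulr0 addr0.
Qed.

(** Induction on [s]: once [x - y] is orthogonal to the tail, correcting it along the head [q] keeps
    that orthogonality, because [q] is orthogonal to the tail. *)
Lemma orth_decomposition s x : hyperbolic s ->
  exists2 y, lin_span (pair_vectors s) y & orth_to s (x - y).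
Proof.
elim: s => [_|q s IHs]; first by exists 0 => //; apply: lin_span0.
rewrite /hyperbolic /= => /andP[/andP[/allP qs ws] /andP[/eqP q12 s12]].
have [|y ys xy] := IHs; first by rewrite /hyperbolic ws.
(* Since [w q.1 q.2 = 1], the coefficient of [q.1] is read off by pairing with [q.2], and that of
   [q.2], up to sign, by pairing with [q.1]. *)
exists (w (x - y) q.2 *: q.1 + (- w (x - y) q.1 *: q.2 + y)).
  apply: lin_spanP.
    by apply: sub_lin_span; exists q; [apply: mem_head | left].
  apply: lin_spanP.
    by apply: sub_lin_span; exists q; [apply: mem_head | right].
  by apply: lin_span_mono ys => z; apply: pair_vectors_cons.
have wE z : w (x - (w (x - y) q.2 *: q.1 + (- w (x - y) q.1 *: q.2 + y))) z
    = w (x - y) z - w (x - y) q.2 * w q.1 z + w (x - y) q.1 * w q.2 z.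
  by rewrite !(linearDl, linearNl, linearZl_LR) /=; ring.
move=> p; rewrite inE !wE => /orP[/eqP->|ps].
  by rewrite !wxx q12 (wC q.2 q.1) q12; split; ring.
have /and4P[/eqP-> /eqP-> /eqP-> /eqP->] := qs _ ps.
by have [-> ->] := xy _ ps; rewrite !mulr0 subr0 addr0.
Qed.

Lemma hyperbolic_cons p s :
    hyperbolic s -> w p.1 p.2 = 1 -> orth_to s p.1 -> orth_to s p.2 ->
  hyperbolic (p :: s).
Proof.
rewrite /hyperbolic /= => /andP[-> ->] -> s1 s2; rewrite eqxx !andbT.
apply/allP => q qs; have [[q1 q2] [q3 q4]] := (s1 q qs, s2 q qs).
by apply/and4P; split; apply/eqP.
Qed.

(** The pair is built from [v] itself if [v] is not yet spanned, and from any unspanned vector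
    otherwise. Each step thus makes progress and also absorbs the prescribed [v]. *)
Lemma extend_hyperbolic s v :
    form_kernel w = [set 0]%classic -> hyperbolic s ->
    ~ (forall x, lin_span (pair_vectors s) x) ->
  exists p, hyperbolic (p :: s) /\ lin_span (pair_vectors (p :: s)) v.
Proof.
move=> w_nondeg hs s_proper.
have [x xNs xv] : exists2 x, ~ lin_span (pair_vectors s) x &
    lin_span (pair_vectors s) v \/ x = v.
  have [vs|vNs] := pselect (lin_span (pair_vectors s) v); last by exists v; auto.
  by have /existsNP[x xNs] := s_proper; exists x; auto.
have [y ys xy] := orth_decomposition x hs.
have [z wz] : exists z, w (x - y) z <> 0.
  apply/existsNP => xyK; apply: xNs.
  suff /eqP : x - y = 0 by rewrite subr_eq0 => /eqP->.
  by have : form_kernel w (x - y) by []; rewrite w_nondeg.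
(* The partner [z] must be made orthogonal to [s] as well. This leaves its product with [x - y]
   unchanged, as [t] lies in the span of [s]; dividing by that product normalises the pair. *)
have [t ts zt] := orth_decomposition z hs.
have wzt : w (x - y) (z - t) = w (x - y) z.
  by rewrite linearBr (orth_to_span xy ts) subr0.
exists (x - y, (w (x - y) z)^-1 *: (z - t)); split.
  apply: hyperbolic_cons => //=.
    by rewrite linearZr_LR /= wzt mulVf //; apply/eqP.
  by move=> p /zt[p1 p2]; rewrite !linearZl_LR /= p1 p2 mulr0.
have s_sub u : lin_span (pair_vectors s) u ->
    lin_span (pair_vectors ((x - y, (w (x - y) z)^-1 *: (z - t)) :: s)) u.
  by apply: lin_span_mono => r; apply: pair_vectors_cons.
case: xv => [/s_sub //|<-].
set p := (x - y, _).
have /(lin_spanP 1)/(_ (s_sub _ ys)) : lin_span (pair_vectors (p :: s)) (x - y).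
  by apply: sub_lin_span; exists p; [apply: mem_head | left].
by rewrite scale1r subrK.
Qed.

(** The index type is left general so that both the finite and the infinite case can use this
    criterion. Spanning is asked only through finite lists of pairs, the form in which the
    construction delivers it. *)
Lemma symplectic_basis_pairs (I : eqType) (b : I -> V * V) :
    (forall i j, i != j -> pair_orth (b i) (b j)) ->
    (forall i, w (b i).1 (b i).2 = 1) ->
    (forall x, exists2 s, {subset s <= [pred p | `[< exists i, p = b i >]]} &
       lin_span (pair_vectors s) x) ->
  symplectic_basis w (fun i => (b i).1) (fun i => (b i).2).
Proof.
move=> b_orth b12 b_span; split=> [i j|i j|i j|x].
- by have [->|/b_orth/and4P[/eqP]] := eqVneq i j; first exact: wxx.
- by have [->|/b_orth/and4P[_ _ _ /eqP]] := eqVneq i j; first exact: wxx.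
- by have [->|/b_orth/and4P[_ /eqP]] := eqVneq i j; first exact: b12.
have [s sb] := b_span x; apply: lin_span_mono => y [p /sb/asboolP[i ->]] [] ->.
  by left; exists i.
by right; exists i.
Qed.

Lemma symplectic_has_basis :
  countably_generated V -> form_kernel w = [set 0]%classic ->
  has_symplectic_basis w.
Proof.
move=> [v v_span] w_nondeg.
have [[s [hs s_span]]|no_finite] :=
    pselect (exists s, hyperbolic s /\ forall x, lin_span (pair_vectors s) x).
  right; exists (size s); have /andP[s_orth /allP s12] := hs.
  exists (fun i => (nth 0 s i).1), (fun i => (nth 0 s i).2).
  apply: (symplectic_basis_pairs (b := fun i : 'I_(size s) => nth 0 s i)).
  - have lt_orth (i j : 'I_(size s)) : (i < j)%N ->
        pair_orth (nth 0 s i) (nth 0 s j).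
      by move=> ij; have /(pairwiseP 0) := s_orth; apply; rewrite ?inE.
    move=> i j; rewrite neq_ltn => /orP[/lt_orth //|/lt_orth].
    exact: pair_orthC.
  - by move=> i; apply/eqP/s12/mem_nth.
  move=> x; exists s => // p ps; apply/asboolP.
  have ip : (index p s < size s)%N by rewrite index_mem.
  by exists (Ordinal ip); rewrite /= nth_index.
(* [g] chooses the next pair from the current list and the index of the generator to absorb; the
   value [0] on non-hyperbolic lists is a dummy that makes [g] total. *)
have /choice[g gP] (sk : seq (V * V) * nat) : exists p, hyperbolic sk.1 ->
    hyperbolic (p :: sk.1) /\ lin_span (pair_vectors (p :: sk.1)) (v sk.2).
  have [hs|hsN] := pselect (hyperbolic sk.1); last by exists 0.
  have [|p] := extend_hyperbolic (v sk.2) w_nondeg hs; last by exists p.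
  by move=> s_span; apply: no_finite; exists sk.1.
(* [S k] lists the first [k] pairs, newest first, and [b k] is the pair added to [S k]. Hence
   [S k.+1] spans [v k]. *)
pose S := fix S k := if k is k'.+1 then g (S k', k') :: S k' else [::].
pose b k := g (S k, k).
have hS k : hyperbolic (S k) by elim: k => //= k /(gP (S k, k))[].
have mem_S i j : (i < j)%N -> b i \in S j.
  elim: j => // j IHj; rewrite ltnS leq_eqVlt inE => /orP[/eqP->|/IHj->].
    by rewrite eqxx.
  exact: orbT.
have S_b k : {subset S k <= [pred p | `[< exists i, p = b i >]]}.
  elim: k => // k IHk p; rewrite inE => /orP[/eqP->|/IHk //].
  by apply/asboolP; exists k.
left; exists (fun i => (b i).1), (fun i => (b i).2).
apply: (symplectic_basis_pairs (b := b)).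
- have lt_orth i j : (i < j)%N -> pair_orth (b j) (b i).
    move=> ij; have /andP[/andP[/allP bS _] _] := hS j.+1.
    exact/bS/mem_S.
  move=> i j; rewrite neq_ltn => /orP[/lt_orth|/lt_orth //].
  exact: pair_orthC.
- by move=> i; have /andP[_ /andP[/eqP]] := hS i.+1.
have S_mono i j : (i <= j)%N -> {subset S i <= S j}.
  move=> /subnK <-; elim: (j - i)%N => // d IHd p /IHd.
  by rewrite addSn inE => ->; rewrite orbT.
move=> x; suff [k xk] : exists k, lin_span (pair_vectors (S k)) x.
  by exists (S k).
have S_span i j y : (i <= j)%N -> lin_span (pair_vectors (S i)) y ->
    lin_span (pair_vectors (S j)) y.
  by move=> ij; apply: lin_span_mono => z [p /(S_mono _ _ ij)]; exists p.
(* The spans of the [S k] increase with [k], so their union is closed under linear combinations; it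
   contains every generator. *)
move: (v_span x); move: x; apply: lin_span_ind => [|a y z [i yi] [j zj]|_ [k _ <-]].
- by exists 0%N; apply: lin_span0.
- by exists (maxn i j); apply: lin_spanP; [apply: S_span yi|apply: S_span zj];
    rewrite ?leq_maxl ?leq_maxr.
by exists k.+1; have [] := gP (S k, k) (hS k).
Qed.

(** * Dimension of a space with a symplectic basis *)

Definition join_families r (e f : 'I_r -> V) (k : 'I_(r + r)) : V :=
  match split k with inl i => e i | inr i => f i end.

(** Pairing a combination with [f j] on the right returns the coefficient of [e j], and pairing it
    with [e j] on the left returns that of [f j]. *)
Lemma symplectic_vectors_indep r (e f : 'I_r -> V) :
    (forall i j, w (e i) (e j) = 0) -> (forall i j, w (f i) (f j) = 0) ->
    (forall i j, w (e i) (f j) = (i == j)%:R) ->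
  lin_indep (join_families e f).
Proof.
move=> ee ff ef c; rewrite big_split_ord /join_families /=.
under eq_bigr => i _ do rewrite (unsplitK (inl i)).
under [X in _ + X]eq_bigr => i _ do rewrite (unsplitK (inr i)).
set x := _ + _ => x0.
have delta (j : 'I_r) (d : 'I_r -> F) : \sum_i d i * (i == j)%:R = d j.
  rewrite (bigD1 j) //= eqxx mulr1 big1 ?addr0 // => i /negPf->.
  by rewrite mulr0.
have xf j : w x (f j) = c (lshift r j).
  rewrite linearDl !linear_sumlz -[RHS](delta j (fun i => c (lshift r i))).
  rewrite -[RHS]addr0; congr (_ + _); [apply: eq_bigr | apply: big1] => i _.
    by rewrite linearZl_LR /= ef.
  by rewrite linearZl_LR /= ff mulr0.
have xe j : w (e j) x = c (rshift r j).
  rewrite linearDr !linear_sumr -[RHS](delta j (fun i => c (rshift r i))).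
  rewrite -[RHS]add0r; congr (_ + _); [apply: big1 | apply: eq_bigr] => i _.
    by rewrite linearZr_LR /= ee mulr0.
  by rewrite linearZr_LR /= ef eq_sym.
move=> k; rewrite -(splitK k); case: (split k) => j /=.
  by rewrite -xf x0 linear0l.
by rewrite -xe x0 linear0r.
Qed.

Lemma symplectic_basis_dim r (e f : 'I_r -> V) n :
  symplectic_basis w e f -> has_dim V n -> n = (r + r)%N.
Proof.
move=> [ee ff ef ef_span] [b [b_free b_span]]; apply/eqP.
rewrite eqn_leq (lin_indep_leq (symplectic_vectors_indep ee ff ef) b_span) andbT.
apply: (lin_indep_leq (c := join_families e f) b_free) => x.
apply: lin_span_mono (ef_span x).
move=> _ [] [i _ <-].
  by exists (lshift r i); rewrite /join_families // (unsplitK (inl i)).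
by exists (rshift r i); rewrite /join_families // (unsplitK (inr i)).
Qed.

(** The first [n.+1] pairs already give more than [n] independent vectors. *)
Lemma infinite_symplectic_basis_dim (e f : nat -> V) n :
  symplectic_basis w e f -> ~ has_dim V n.
Proof.
move=> [ee ff ef _] [b [_ b_span]].
have /lin_indep_leq/(_ b_span) :
    lin_indep (join_families (r := n.+1) (fun i => e i) (fun i => f i)).
  exact: symplectic_vectors_indep.
by rewrite addSn ltnNge leq_addr.
Qed.

End SymplecticBasis.

(** * Complements of the kernel *)

Section Complements.
Context {F : fieldType} {V : lmodType F} (w : {biscalar V}).
Implicit Types (x y : V) (L : submodClosed V).
Local Notation K := (form_kernel w).

Lemma form_kernelP a x y : K x -> K y -> K (a *: x + y).
Proof.
by move=> Kx Ky z; rewrite linearDl linearZl_LR /= Kx Ky mulr0 addr0.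
Qed.

Lemma subspace_valB L (l l' : subspace L) : val l - val l' \in L.
Proof.
rewrite -scaleN1r; have Ll := valP l; have Ll' := valP l'.
by apply: rpredD; [apply: Ll | apply: rpredZ; apply: Ll'].
Qed.

(** Any choice of [L]-components is automatically linear: the defect of linearity lies in both the
    kernel and [L], hence vanishes. *)
Lemma complement_projection L : complementary K L ->
  exists P : {linear V -> subspace L}, forall x, K (x - val (P x)).
Proof.
move=> [KL KL0].
have /choice[p pP] x : exists l : subspace L, K (x - val l).
  by have [k [l [Kk Ll ->]]] := KL x; exists (Sub l Ll); rewrite SubK addrK.
have p_linear : linear p.
  move=> a x y; apply/val_inj/eqP; rewrite -subr_eq0; apply/eqP/KL0.
    (* The defect is regrouped as a combination of three residues of the form [x - val (p x)], each
       in the kernel. *)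
    have -> : val (p (a *: x + y)) - val (a *: p x + p y) =
        - 1 *: (a *: x + y - val (p (a *: x + y))) +
        (a *: (x - val (p x)) + (y - val (p y))).
      rewrite scaleN1r opprB scalerBr (addrACA (a *: x)) -opprD addrA subrK.
      by rewrite raddfD /= linearZ.
    by do !apply: form_kernelP.
  exact: subspace_valB.
pose pL := GRing.isLinear.Build F V (subspace L) *:%R p p_linear.
pose P : {linear V -> subspace L} := HB.pack p pL.
by exists P.
Qed.

Section Restriction.
Variable L : submodClosed V.
Hypotheses (KL : complementary K L) (w_skew : skew_form w).

Lemma complement_unique (l l' : subspace L) : K (val l - val l') -> l = l'.
Proof.
move=> Kll'; apply/val_inj/eqP; rewrite -subr_eq0; apply/eqP.
by apply: (proj2 KL) => //; apply: subspace_valB.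
Qed.

Lemma form_mod_kernel x x' y y' : K (x - x') -> K (y - y') -> w x y = w x' y'.
Proof.
move=> Kx Ky; rewrite -[x](subrK x') linearDl /= Kx add0r.
rewrite -[y](subrK y') linearDr /=; have [-> _] := w_skew x' (y - y').
by rewrite Ky oppr0 add0r.
Qed.

Lemma restr_symplectic :
  countably_generated V -> symplectic_space (w |_[L]).
Proof.
move=> [v v_span]; have [P KP] := complement_projection KL; split.
  (* The projections of the generators generate [L], because [P] fixes every element of [L]. *)
  exists (fun n => P (v n)) => l; have -> : l = P (val l).
    by apply/esym/complement_unique; rewrite -opprB -scaleN1r -[_ *: _]addr0;
      apply: form_kernelP => // y; rewrite linear0l.
  move: (v_span (val l)); move: (val l).
  apply: lin_span_ind => [|a x y Px Py|_ [n _ <-]].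
  - by rewrite linear0; apply: lin_span0.
  - by rewrite linearP; apply: lin_spanP.
  - by apply: sub_lin_span; exists n.
split=> [x y|]; first exact: w_skew.
apply/seteqP; split=> [l Kl|_ -> y]; last by rewrite linear0l.
apply: complement_unique => y; rewrite subr0.
(* Replacing [y] by its projection does not change the form, so a vector of [L] orthogonal to [L] is
   orthogonal to all of [V]. *)
rewrite -(Kl (P y)); apply: form_mod_kernel => //.
by rewrite subrr => z; rewrite linear0l.
Qed.

End Restriction.

Lemma complements_congruent L L' :
    skew_form w -> complementary K L -> complementary K L' ->
  congruent (w |_[L]) (w |_[L']).
Proof.
move=> w_skew KL KL'.
have [P KP] := complement_projection KL.
have [P' KP'] := complement_projection KL'.
have KN x y : K (x - y) -> K (y - x).
  by move=> Kxy z; rewrite -opprB linearNl /= Kxy oppr0.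
have KT x y z : K (x - y) -> K (y - z) -> K (x - z).
  by move=> Kxy Kyz t; rewrite -[x](subrK y) -addrA linearDl /= Kxy Kyz addr0.
pose T := P' \o val : subspace L -> subspace L'.
exists T; split.
  exists (fun l => P (val l)) => l.
    by apply: (complement_unique KL); apply: (KT _ (val (T l))); apply: KN.
  by apply: (complement_unique KL'); apply: (KT _ (val (P (val l)))); apply: KN.
move=> x y; apply: form_mod_kernel => //; exact/KN/KP'.
Qed.

End Complements.

Theorem theoremA (F : fieldType) :
  (forall (V : lmodType F) (w : {biscalar V}),
     symplectic_space w ->
     has_symplectic_basis w /\
     ((exists x : V, x <> 0) ->
      forall n : nat, has_dim V n -> exists r : nat, (1 <= r)%N /\ n = (2 * r)%N))
  /\
  (forall (V : lmodType F) (w : {biscalar V}),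
     countably_generated V ->
     skew_form w ->
     forall L : submodClosed V,
       complementary (form_kernel w) L ->
       symplectic_space (w |_[L]) /\
       forall L' : submodClosed V,
         complementary (form_kernel w) L' ->
         congruent (w |_[L]) (w |_[L'])).
Proof.
split=> V w.
  move=> [V_cg [w_skew w_nondeg]].
  have basis := symplectic_has_basis w_skew V_cg w_nondeg; split=> // -[x x0] n dimV.
  have [[e [f /infinite_symplectic_basis_dim/(_ dimV)]]|[r [e [f ef]]]] := basis.
    (* An infinite symplectic basis is incompatible with finite dimension. *)
    by case.
  have nE := symplectic_basis_dim ef dimV.
  (* If [r] were [0], the dimension would be [0] and every vector an empty sum, against [x <> 0]. *)
  exists r; rewrite mul2n -addnn; split=> //; case: r {e f ef} nE => // n0.
  have [b [_ b_span]] := dimV; case: x0; have [c ->] := lin_span_range (b_span x).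
  by subst n; apply: big1 => -[].
move=> V_cg w_skew L KL; split; first exact: restr_symplectic.
by move=> L' KL'; apply: complements_congruent.
Qed.
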